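(* There exists a gyrogroup $(G,\oplus)$ of order $16$ such that the set of all gyrators $\{\mathrm{gyr}[a,b] : a,b\in G\}$ is not a group under composition (that is, it is not a subgroup of the automorphism group $\mathrm{Aut}(G)$).
   Context: A gyrogroup is a pair $(G,\oplus)$ consisting of a nonempty set $G$ and a binary operation $\oplus$ on $G$ satisfying: (G1) there exists an element $0\in G$ such that $0\oplus x=x$ for all $x\in G$; (G2) for each $a\in G$ there exists $b\in G$ such that $b\oplus a=0$; (G3) there exists a function $\mathrm{gyr}: G\times G\to \mathrm{Aut}(G)$ such that for all $a,b,c\in G$, $a\oplus(b\oplus c)=(a\oplus b)\oplus \mathrm{gyr}[a,b](c)$; (G4) for all $a,b\in G$, $\mathrm{gyr}[a,b]=\mathrm{gyr}[a\oplus b,b]$. Here $\mathrm{Aut}(G)$ is the group of all bijections $\varphi:G\to G$ with $\varphi(x\oplus y)=\varphi(x)\oplus\varphi(y)$ for all $x,y\in G$. The map $\mathrm{gyr}[a,b]$ is called the gyrator, or gyroautomorphism, generated by $a$ and $b$. In a gyrogroup the element $0$ is a two-sided identity, every element $a$ has a unique two-sided inverse $\ominus a$, and $\mathrm{gyr}[a,b](c)=\ominus(a\oplus b)\oplus(a\oplus(b\oplus c))$, so the function $\mathrm{gyr}$ is determined by $\oplus$. *)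

(* Defs.v *)
From mathcomp Require Import all_boot all_fingroup.

Set Implicit Arguments.
Unset Strict Implicit.
Unset Printing Implicit Defensive.

Definition automorphism_of (G : Type) (op : G -> G -> G) (f : G -> G) : Prop :=
  bijective f /\ {morph f : x y / op x y}.

Record is_gyrogroup (G : Type) (op : G -> G -> G) (zero : G)
    (gyr : G -> G -> G -> G) : Prop := IsGyrogroup {
  gyro_left_id : forall x, op zero x = x;
  gyro_left_inv : forall a, exists b, op b a = zero;
  gyro_aut : forall a b, automorphism_of op (gyr a b);
  gyro_assoc : forall a b c, op a (op b c) = op (op a b) (gyr a b c);
  gyro_loop : forall a b, gyr a b =1 gyr (op a b) b
}.

Section Gyrators.

Context (G : finType) (op : G -> G -> G) (zero : G) (gyr : G -> G -> G -> G).
Context (gyroG : is_gyrogroup op zero gyr).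

Lemma gyr_inj a b : injective (gyr a b).
Proof. by case: (gyro_aut gyroG a b) => /bij_inj. Qed.

Definition gyrator (a b : G) : {perm G} := perm (@gyr_inj a b).

Lemma gyratorE a b : gyrator a b =1 gyr a b.
Proof. exact: permE. Qed.

Lemma gyrator_aut a b : automorphism_of op (gyrator a b).
Proof.
split; first by exists (gyrator a b)^-1%g; [apply: permK | apply: permKV].
by move=> x y; rewrite !gyratorE (gyro_aut gyroG a b).2.
Qed.

(* All members are automorphisms (gyrator_aut), so this set is a subgroup of
   Aut(G) iff it is a subgroup of {perm G}, i.e. iff group_set holds of it.
   The product of {perm G} is composition in diagrammatic order, which does not
   affect being a subgroup. *)
Definition gyrators : {set {perm G}} :=
  [set gyrator a b | a in [set: G], b in [set: G]].

End Gyrators.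

(* Main.v *)
Require Import Defs.
From mathcomp Require Import all_boot all_fingroup.
From mathcomp Require Import ssralg.

(** Let V and W be elementary abelian 2-groups and attach to every a in V a
    homomorphism g a : V -> W, with g 0 = 0 and otherwise arbitrary.  Twist the
    product V * W by the factor set (a, b) |-> g a b.  The failure of
    associativity is then c |-> D a b c, where
    D a b = g a + g b + g (a + b) is again a homomorphism V -> W; adding it to
    the W-coordinate is an automorphism, because W is central and the factor set
    does not involve W-coordinates.  The expression D a b is
    symmetric in the three vectors a, b, a + b, which gives the loop property.
    Hence every such g yields a gyrogroup (lemma twisted_gyrogroup), and
    composing gyrators amounts to adding the corresponding D a b.

    It remains to choose g so that the values D a b are not closed under
    addition.  Take V = F_2^3, W = F_2, and view the nonzero vectors as points of
    the Fano plane.  When a, b are distinct and nonzero, D a b is the sum of g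
    over the line {a, b, a + b}; otherwise it vanishes.  Fix a line L, two
    independent linear forms alpha and beta, and let g take the values alpha,
    beta, beta on the three points of L and 0 off L.  A line other than L
    meets L in exactly one point and contributes alpha or beta, while L itself
    contributes alpha + 2 beta = alpha.  The gyrators are thus the shifts by
    0, alpha and beta; the product of the last two is the shift by
    alpha + beta, which is not among them (lemma fano_defect_not_sum). *)

Set Implicit Arguments.
Unset Strict Implicit.
Unset Printing Implicit Defensive.

Import GRing.Theory.

Section TwistedProduct.

Local Open Scope ring_scope.

Variables (V W : zmodType) (g : V -> V -> W).

Definition twisted_op (x y : V * W) : V * W :=
  (x.1 + y.1, x.2 + y.2 + g x.1 y.1).

Definition twist_defect (a b c : V) : W := g a c + g b c + g (a + b) c.

Definition twisted_gyr (x y z : V * W) : V * W :=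
  (z.1, z.2 + twist_defect x.1 y.1 z.1).

Hypothesis addVV : forall v : V, v + v = 0.
Hypothesis addWW : forall w : W, w + w = 0.
Hypothesis g0 : forall c, g 0 c = 0.
Hypothesis gD : forall a, {morph g a : c d / c + d}.

Lemma twist_defectD a b : {morph twist_defect a b : c d / c + d}.
Proof.
move=> c d; rewrite /twist_defect !gD [RHS]addrACA.
by congr (_ + _); rewrite addrACA.
Qed.

Lemma twisted_gyr_aut x y : automorphism_of twisted_op (twisted_gyr x y).
Proof.
split.
  exists (twisted_gyr x y) => -[c u];
    by rewrite /twisted_gyr /= -addrA addWW addr0.
move=> [c u] [d v]; rewrite /twisted_gyr /twisted_op /= twist_defectD.
by congr (_, _); rewrite addrAC; congr (_ + _); rewrite addrACA.
Qed.

Lemma twisted_assoc x y z :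
  twisted_op x (twisted_op y z)
  = twisted_op (twisted_op x y) (twisted_gyr x y z).
Proof.
case: x y z => [a s] [b t] [c u]; rewrite /twisted_gyr /twisted_op /=.
congr (_, _); first by rewrite addrA.
rewrite /twist_defect gD.
(* the term g (a + b) c occurs twice on the right and cancels *)
rewrite -!addrA addWW addr0 !addrA.
by rewrite [LHS](ACl (1*2*5*3*6*4)).
Qed.

(** In exponent 2 both sides sum g over the same three vectors, as
    (a + b) + b = a. *)
Lemma twist_defect_loop a b c :
  twist_defect a b c = twist_defect (a + b) b c.
Proof.
by rewrite /twist_defect -(addrA a) addVV addr0 [LHS](ACl (3*2*1)).
Qed.

Lemma twisted_gyrogroup : is_gyrogroup twisted_op 0 twisted_gyr.
Proof.
split.
- by move=> [c u]; rewrite /twisted_op /= g0 !add0r addr0.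
- move=> [a s]; exists (a, s + g a a); rewrite /twisted_op /= addVV.
  by rewrite -addrA addWW.
- exact: twisted_gyr_aut.
- exact: twisted_assoc.
- by move=> [a s] [b t] [c u]; rewrite /twisted_gyr /= -twist_defect_loop.
Qed.

End TwistedProduct.

Definition fano : zmodType := (bool * bool * bool)%type.

(** The line L is z = 0; the coordinate forms x and y play the roles of alpha,
    attached to (1,0,0), and of beta, attached to (0,1,0) and (1,1,0). *)
Definition fano_form (a c : fano) : bool :=
  let: (x, y, z) := a in
  (([&& x, ~~ y & ~~ z] && c.1.1) (+) ((y && ~~ z) && c.1.2))%B.

Lemma fano_formD a : {morph fano_form a : c d / (c + d)%R}.
Proof. by case: a => [[[] []] []] [[[] []] []] [[[] []] []]. Qed.

(** Being 1 at both (1,0,0) and (0,1,0) means being alpha + beta up to a multiple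
    of z.  No D a b is of that kind: the only line through the point carrying
    alpha and a point carrying beta is L, on which beta occurs twice. *)
Lemma fano_defect_not_sum (a b : fano) :
  ~~ (twist_defect fano_form a b (true, false, false)
      && twist_defect fano_form a b (false, true, false)).
Proof. by case: a b => [[[] []] []] [[[] []] []]. Qed.

Lemma fano_gyrogroup :
  is_gyrogroup (twisted_op fano_form) 0%R (twisted_gyr fano_form).
Proof.
apply: twisted_gyrogroup.
- by case=> [[[] []] []].
- by case.
- by [].
- exact: fano_formD.
Qed.

Lemma fano_gyrators_not_group : ~~ group_set (gyrators fano_gyrogroup).
Proof.
apply/negP => /group_setP[_ gyrM].
(* Each pair spans a line through (0,0,1), which lies off L: the first meets L
   in (1,0,0) only and gives alpha, the second in (0,1,0) only and gives beta. *)
pose r := gyrator fano_gyrogroup ((true, false, false), false)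
                                 ((false, false, true), false).
pose s := gyrator fano_gyrogroup ((false, true, false), false)
                                 ((false, false, true), false).
have: (r * s)%g \in gyrators fano_gyrogroup.
  by apply: gyrM; apply: imset2_f; rewrite inE.
case/imset2P => x y _ _ rsE.
have shift c : twist_defect fano_form x.1 y.1 c = ((r * s)%g (c, false)).2.
  by rewrite rsE gyratorE /= add0r.
have := fano_defect_not_sum x.1 y.1.
by rewrite !shift !permM !gyratorE.
Qed.

Theorem theorem1p2 :
  exists (G : finType) (op : G -> G -> G) (zero : G) (gyr : G -> G -> G -> G)
    (gyroG : is_gyrogroup op zero gyr),
    #|G| = 16 /\ ~~ group_set (gyrators gyroG).
Proof.
exists (bool * bool * bool * bool)%type, (twisted_op fano_form), 0%R.
exists (twisted_gyr fano_form), fano_gyrogroup; split.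
  by rewrite !card_prod card_bool.
exact: fano_gyrators_not_group.
Qed.
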